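(* For the path graph $P_{2k}$ with $k\in\mathbb{N}$ and $2k\geq 4$, $$C_s(P_{2k})=4.$$
   Context: All graphs are finite, simple and undirected. $P_n$ denotes the path on $n$ vertices. $N(v)$ denotes the open neighborhood of a vertex $v$, and for $S\subseteq V(G)$ we write $\overline{S}=V(G)\setminus S$. A set $S\subseteq V(G)$ is a dominating set if every vertex of $\overline{S}$ is adjacent to a vertex of $S$. A dominating set $S$ is a super dominating set if for every $u\in\overline{S}$ there exists $v\in S$ with $N(v)\cap\overline{S}=\{u\}$. A super coalition partition of $G$ is a partition $\{A_1,\dots,A_m\}$ of $V(G)$ (into nonempty parts) such that (i) no part $A_i$ is a super dominating set of $G$, and (ii) for every part $A_i$ there is at least one distinct part $A_j$ ($j\neq i$) such that $A_i\cup A_j$ is a super dominating set of $G$. The super coalition number $C_s(G)$ is the maximum cardinality of a super coalition partition of $G$, with $C_s(G)=0$ if $G$ admits no super coalition partition. *)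

(* Defs.v *)
From mathcomp Require Import all_boot.

Set Implicit Arguments.
Unset Strict Implicit.
Unset Printing Implicit Defensive.

Record sgraph := SGraph {
  vertex :> finType;
  adj : rel vertex;
  adj_sym : symmetric adj;
  adj_irr : irreflexive adj }.

Section SuperCoalition.
Variable G : sgraph.
Implicit Types (S A B : {set G}) (P : {set {set G}}).

Definition nbh (v : G) : {set G} := [set u | adj v u].

Definition dominating S : bool :=
  [forall u in ~: S, [exists v in S, adj u v]].

Definition super_dominating S : bool :=
  dominating S &&
  [forall u in ~: S, [exists v in S, nbh v :&: ~: S == [set u]]].

(* [partition] from finset already requires the parts to be nonempty. *)
Definition super_coalition_partition P : bool :=
  [&& partition P [set: G],
      [forall A in P, ~~ super_dominating A] &
      [forall A in P, [exists B in P,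
         (B != A) && super_dominating (A :|: B)]]].

(* The maximum over an empty family is 0. *)
Definition super_coalition_number : nat :=
  \max_(P : {set {set G}} | super_coalition_partition P) #|P|.

End SuperCoalition.

(* Vertices 0, ..., n-1, consecutive ones being adjacent. *)
Definition path_adj (n : nat) : rel 'I_n :=
  fun i j => (i.+1 == j :> nat) || (j.+1 == i :> nat).

Lemma path_adj_sym n : symmetric (@path_adj n).
Proof. by move=> i j; rewrite /path_adj orbC. Qed.

Lemma path_adj_irr n : irreflexive (@path_adj n).
Proof. by move=> i; rewrite /path_adj orbb gtn_eqF. Qed.

Definition path_graph (n : nat) : sgraph :=
  SGraph (@path_adj_sym n) (@path_adj_irr n).

(* Main.v *)
(** A super dominating set [S] has at least as many vertices as its complement,
    since distinct outside vertices have distinct private neighbours in [S].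
    Call two parts partners when their union is super dominating.  Two disjoint
    pairs of partners therefore already cover the graph, and the partition has
    at most four parts.  Without two disjoint pairs the partner relation (on at
    least four parts) is a star with some centre [A].  Pick [u] outside [A]
    with no private neighbour in [A]: every partner of [A] avoiding [u]
    contributes its own neighbour of [u], so [A] has at most [deg u + 1 <= 3]
    partners.

    Conversely, the vertices of [P_2k] congruent to 1 or 2 modulo 4 and their
    complement are both super dominating, and splitting a vertex off each of
    them gives four parts, each too small to be super dominating. *)

Require Import Defs.
From mathcomp Require Import all_boot zify.

Set Implicit Arguments.
Unset Strict Implicit.
Unset Printing Implicit Defensive.

(** * Super dominating sets and their size *)

Section SuperDomination.
Variable G : sgraph.
Implicit Types (S A B C D : {set G}) (P : {set {set G}}) (u v : G).

Lemma super_dominatingE S :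
  super_dominating S =
    [forall u in ~: S, [exists v in S, nbh v :&: ~: S == [set u]]].
Proof.
rewrite /super_dominating andb_idl // => /forall_inP sup.
apply/forall_inP => u /sup/exists_inP[v vS /eqP vu]; apply/exists_inP.
exists v => //; have : u \in nbh v :&: ~: S by rewrite vu set11.
by rewrite !inE adj_sym => /andP[].
Qed.

Lemma super_dominatingP S :
  reflect (forall u, u \notin S ->
             exists2 v, v \in S & nbh v :&: ~: S = [set u])
          (super_dominating S).
Proof.
rewrite super_dominatingE; apply: (iffP forall_inP) => sup u uS.
  have /exists_inP[v vS /eqP vu] : [exists v in S, nbh v :&: ~: S == [set u]].
    by apply: sup; rewrite inE.
  by exists v.
rewrite inE in uS; have [v vS vu] := sup u uS.
by apply/exists_inP; exists v => //; rewrite vu.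
Qed.

Lemma super_dominating_card S : super_dominating S -> #|~: S| <= #|S|.
Proof.
(* Counting singletons avoids choosing private neighbours: each [[set u]] with [u] outside [S] is a
   value of [nbh v :&: ~: S] on [S]. *)
move=> /super_dominatingP sup; rewrite -(card_imset _ (@set1_inj G)).
apply: leq_trans (leq_imset_card (fun v => nbh v :&: ~: S) S).
apply/subset_leq_card/subsetP => _ /imsetP[u uS ->].
rewrite inE in uS; have [v vS vu] := sup u uS.
by apply/imsetP; exists v.
Qed.

(** Here [#|A| < #|S| <= #|~: S| < #|~: A|], so [A] is too small. *)
Lemma properN_super_dominating S A :
  super_dominating (~: S) -> A \proper S -> ~~ super_dominating A.
Proof.
move=> /super_dominating_card; rewrite setCK => leS AS.
apply/negP => /super_dominating_card leA.
have := proper_card AS; have : #|~: S| < #|~: A| by rewrite proper_card ?properC.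
lia.
Qed.

Lemma super_dominating_disjoint_cover S A :
  super_dominating S -> super_dominating A -> [disjoint S & A] ->
  S :|: A = setT.
Proof.
move=> /super_dominating_card leS /super_dominating_card leA dSA.
apply/eqP; rewrite eqEcard subsetT cardsT cardsU.
have -> : #|S :&: A| = 0 by apply/eqP; rewrite cards_eq0 setI_eq0.
by have := cardsC S; have := cardsC A; lia.
Qed.

(** * The partner relation and the upper bound *)

Definition partner P A B : bool :=
  [&& A \in P, B \in P, B != A & super_dominating (A :|: B)].

Lemma partner_sym P A B : partner P A B = partner P B A.
Proof. by rewrite /partner setUC eq_sym andbCA. Qed.

Lemma card_partner P A d :
    trivIset P -> ~~ super_dominating A -> (forall u, #|nbh u| <= d) ->
  #|[set B | partner P A B]| <= d.+1.
Proof.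
move=> trivP; rewrite super_dominatingE => /forall_inPn[u].
rewrite !inE => uA /exists_inPn noprivA deg.
pose priv B v := (v \in A :|: B) && (nbh v :&: ~: (A :|: B) == [set u]).
(* The default [u] is never taken on [D], by [fP]. *)
pose f B := odflt u [pick v | priv B v].
pose D := [set B | partner P A B & u \notin B].
have fP B : B \in D -> priv B (f B).
  rewrite inE => /andP[/and4P[_ _ _ /super_dominatingP sup] uB].
  have [|v vAB /eqP vu] := sup u; first by rewrite inE negb_or uA.
  rewrite /f; case: pickP => [//|/(_ v)].
  by rewrite /priv vAB vu.
have f_nbh B : B \in D -> f B \in nbh u.
  move=> /fP/andP[_ /eqP vu].
  have : u \in nbh (f B) :&: ~: (A :|: B) by rewrite vu set11.
  by rewrite !inE adj_sym => /andP[].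
have f_inj : {in D &, injective f}.
  (* If the common private neighbour [v] lies in [A], it has a further
     neighbour [w] outside [A], which has to lie in both parts. *)
  move=> B C BD CD eqf; move: (fP B BD) (fP C CD); rewrite -eqf.
  set v := f B => /andP[vB /eqP nB] /andP[vC /eqP nC].
  have [[BP uB] [CP uC]] : (B \in P /\ u \notin B) /\ (C \in P /\ u \notin C).
    by move: BD CD; rewrite !inE => /andP[/and4P[]] + + + + + /andP[/and4P[]].
  suff [w wB wC] : exists2 w, w \in B & w \in C.
    by rewrite -(def_pblock trivP BP wB) (def_pblock trivP CP wC).
  case: (boolP (v \in A)) => [vA|vA]; last first.
    by exists v; [move: vB | move: vC]; rewrite inE (negPf vA).
  have adjvu : adj v u.
    have : u \in nbh v :&: ~: (A :|: B) by rewrite nB set11.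
    by rewrite !inE => /andP[].
  have [w wnu] : exists2 w, w != u & w \in nbh v :&: ~: A.
    apply/exists_inP/contraT => /exists_inPn noother.
    case/negP: (noprivA v vA); rewrite eqEsubset sub1set !inE adjvu uA /= andbT.
    by apply/subsetP => w; rewrite inE; apply: contraLR => /noother.
  rewrite !inE => /andP[vw wA].
  have mem X : nbh v :&: ~: (A :|: X) = [set u] -> w \in X.
    move=> nX; apply/contraT => wX.
    by move: wnu; rewrite -in_set1 -nX !inE vw negb_or wA wX.
  by exists w; apply: mem.
have cardD : #|D| <= d.
  rewrite -(card_in_imset f_inj); apply: leq_trans (deg u).
  by apply/subset_leq_card/subsetP => _ /imsetP[B BD ->]; apply: f_nbh.
(* At most one part contains [u]; it accounts for the extra 1 in [d.+1]. *)
have sub : [set B | partner P A B] \subset pblock P u |: D.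
  apply/subsetP => B; rewrite !inE => AB; rewrite AB /=.
  case: (boolP (u \in B)) => uB; last by rewrite orbT.
  by case/and4P: AB => _ BP _ _; rewrite (def_pblock trivP BP uB) eqxx.
apply: leq_trans (subset_leq_card sub) _.
by rewrite cardsU1 -add1n leq_add ?leq_b1.
Qed.

Lemma disjoint_partners_card P A B C D :
    partition P setT -> partner P A B -> partner P C D ->
    C \notin [set A; B] -> D \notin [set A; B] ->
  #|P| <= 4.
Proof.
move=> partP /and4P[AP BP _ supAB] /and4P[CP DP _ supCD].
rewrite !inE !negb_or => /andP[nCA nCB] /andP[nDA nDB].
have /trivIsetP disj := partition_trivIset partP.
have covAll : A :|: B :|: (C :|: D) = setT.
  apply: super_dominating_disjoint_cover => //.
  rewrite -setI_eq0 setIUl !setIUr !setU_eq0 !setI_eq0.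
  by rewrite !disj // eq_sym.
(* Parts are nonempty and pairwise disjoint, so each one shares a vertex with, and hence equals, one
   of the four. *)
have sub : P \subset [set A; B; C; D].
  apply/subsetP => E EP; have /set0Pn[x xE] := partition_neq0 partP EP.
  have : x \in A :|: B :|: (C :|: D) by rewrite covAll.
  have eqE X : X \in P -> x \in X -> E = X.
    move=> XP xX; have trivP := partition_trivIset partP.
    by rewrite -(def_pblock trivP EP xE) (def_pblock trivP XP xX).
  rewrite !inE => /orP[/orP[]|/orP[]] /eqE-> //; by rewrite eqxx ?orbT.
apply: leq_trans (subset_leq_card sub) _.
rewrite setUC cardsU1 setUC cardsU1 cards2.
by case: (D \notin _); case: (C \notin _); case: (A != B).
Qed.

Lemma super_coalition_partition_card P :
  (forall u : G, #|nbh u| <= 2) -> super_coalition_partition P -> #|P| <= 4.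
Proof.
move=> deg /and3P[partP /forall_inP nsup /forall_inP coal].
have trivP := partition_trivIset partP.
have ex_partner A : A \in P -> exists B, partner P A B.
  move=> AP; have /exists_inP[B BP /andP[nBA sup]] := coal A AP.
  by exists B; rewrite /partner AP BP nBA.
rewrite leqNgt; apply/negP => gt4.
have meet A B C D : partner P A B -> partner P C D ->
    (C \in [set A; B]) || (D \in [set A; B]).
  move=> pAB pCD; apply/contraT; rewrite negb_or => /andP[nC nD].
  by have := disjoint_partners_card partP pAB pCD nC nD; rewrite leqNgt gt4.
have [A [B AB]] : exists A B, partner P A B.
  have /card_gt0P[A AP] : 0 < #|P| by lia.
  by exists A; apply: ex_partner.
have [C CP] : exists2 C, C \in P & C \notin [set A; B].
  apply/subsetPn/negP => /subset_leq_card /(leq_trans gt4).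
  by rewrite cards2; case: (A != B).
rewrite !inE negb_or => /andP[nCA nCB].
(* If [A'] has two partners [B'] and [C], the partner of any other part must lie in both pairs, so
   it is [A']. Hence [P] consists of [A'] and its at most 3 partners. *)
have star A' B' : partner P A' B' -> partner P A' C -> C != B' -> False.
  move=> {AB nCA nCB A B} pAB pAC nCB.
  have sub : P \subset A' |: [set X | partner P A' X].
    apply/subsetP => X XP; rewrite !inE; apply/norP => -[nXA nAX].
    have [nXB nXC] : X != B' /\ X != C.
      by split; apply: contraNneq nAX => ->.
    have [Y XY] := ex_partner X XP.
    have := meet _ _ _ _ pAB XY; have := meet _ _ _ _ pAC XY.
    rewrite !inE (negPf nXA) (negPf nXB) (negPf nXC) /=.
    case: eqP XY => [->|_ _ /eqP->]; first by rewrite partner_sym (negPf nAX).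
    by rewrite (negPf nCB).
  have /and4P[AP _ _ _] := pAB.
  have := leq_trans gt4 (subset_leq_card sub); rewrite leqNgt => /negP[].
  rewrite ltnS cardsU1 -[4]/(1 + 3) leq_add ?leq_b1 //.
  exact: card_partner trivP (nsup _ AP) deg.
(* The partner of [C] is [A] or [B], and that part is the centre of the star. *)
have [D CD] := ex_partner C CP.
have := meet _ _ _ _ AB CD; rewrite !inE (negPf nCA) (negPf nCB) /=.
move: CD; rewrite partner_sym => CD /orP[] /eqP DE; rewrite {}DE in CD.
  exact: star AB CD nCB.
by rewrite partner_sym in AB; apply: star AB CD nCA.
Qed.

End SuperDomination.

(** * Lower bound from two complementary super dominating sets *)

Section Split.
Variable G : sgraph.
Implicit Types (S : {set G}) (x y : G).

Lemma super_coalition_number_ge4 S x y z w :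
    super_dominating S -> super_dominating (~: S) ->
    x \in S -> y \in S -> x != y -> z \notin S -> w \notin S -> z != w ->
  4 <= super_coalition_number G.
Proof.
move=> supS supC xS yS xy zS wS zw.
(* The vertices [y] and [w] keep the remainders [A] and [B] nonempty. Each of the four parts is a
   proper subset of [S] or of [~: S]. *)
pose A := S :\ x; pose B := ~: S :\ z.
have AE : [set x] :|: A = S by rewrite setD1K.
have BE : [set z] :|: B = ~: S by rewrite setD1K // inE.
have yA : y \in A by rewrite !inE eq_sym xy.
have wB : w \in B by rewrite !inE eq_sym zw.
have xA : x \notin A by rewrite !inE eqxx.
have zB : z \notin B by rewrite !inE eqxx.
have xB : x \notin B by rewrite !inE xS andbF.
have zA : z \notin A by rewrite !inE (negPf zS) andbF.
have yB : y \notin B by rewrite !inE yS andbF.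
have neq (X Y : {set G}) (v : G) : v \in X -> v \notin Y -> (X == Y) = false.
  by move=> vX vY; apply/negP => /eqP XY; rewrite XY (negPf vY) in vX.
have xz : x \notin [set z] by rewrite inE; apply: contraNneq zS => <-.
have /= distinct := (neq _ _ _ (set11 x) xA, neq _ _ _ (set11 x) xB,
  neq _ _ _ (set11 x) xz, neq _ _ _ (set11 z) zB,
  neq _ _ _ yA yB, neq _ _ _ (set11 z) zA).
pose P := [set x] |: (A |: ([set z] |: (B |: set0))).
have partP : partition P setT.
  have -> : [set: G] = [set x] :|: (A :|: ([set z] :|: (B :|: set0))).
    by rewrite setU0 setUA AE BE setUCr.
  have P0 : partition (set0 : {set {set G}}) set0 by rewrite partition_set0.
  have nonempty (X : {set G}) v : v \in X -> X != set0.
    by move=> vX; apply/set0Pn; exists v.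
  do !apply: partitionU1; rewrite ?disjoints1 ?setU0 //.
  - exact: nonempty _ _ wB.
  - by rewrite disjoint_sym -setI_eq0 set0I.
  - exact: nonempty _ _ (set11 z).
  - exact: nonempty _ _ yA.
  - by rewrite BE disjoints_subset setCK subD1set.
  - exact: nonempty _ _ (set11 x).
  - by rewrite BE !inE eqxx xS.
have cardP : #|P| = 4.
  by rewrite !cardsU1 cards0 !in_setU1 !in_set0 (eq_sym A [set z]) !distinct.
rewrite -cardP; apply: (bigmax_sup P) => //; rewrite /super_coalition_partition.
have nsupX : ~~ super_dominating [set x].
  apply: properN_super_dominating supC _; rewrite properE sub1set xS.
  by apply/subsetPn; exists y; rewrite // inE eq_sym.
have nsupA : ~~ super_dominating A.
  by apply: properN_super_dominating supC _; rewrite properD1.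
have nsupZ : ~~ super_dominating [set z].
  apply: (@properN_super_dominating _ (~: S)); rewrite ?setCK //.
  rewrite properE sub1set inE zS.
  by apply/subsetPn; exists w; rewrite ?inE // eq_sym.
have nsupB : ~~ super_dominating B.
  by apply: (@properN_super_dominating _ (~: S)); rewrite ?setCK // properD1 ?inE.
have [xP AP zP BP] : [/\ [set x] \in P, A \in P, [set z] \in P & B \in P].
  by rewrite !inE !eqxx ?orbT.
rewrite partP /=; apply/andP; split; apply/forall_inP => X.
  by rewrite 4!in_setU1 in_set0 orbF => /or4P[] /eqP->.
rewrite 4!in_setU1 in_set0 orbF => /or4P[] /eqP->; apply/exists_inP.
- by exists A; rewrite // AE supS eq_sym distinct.
- by exists [set x]; rewrite // setUC AE supS distinct.
- by exists B; rewrite // BE supC eq_sym distinct.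
- by exists [set z]; rewrite // setUC BE supC distinct.
Qed.

End Split.

(** * Path graphs *)

Lemma card_nbh_path n (u : path_graph n) : #|nbh u| <= 2.
Proof.
rewrite cardE -(size_map val).
(* At [u = 0] the entry [u.-1] is not a neighbour, which is harmless for an upper bound. *)
apply: (@uniq_leq_size _ _ [:: u.-1; u.+1 : nat]).
  by rewrite map_inj_uniq ?enum_uniq //; apply: val_inj.
move=> x /mapP[v]; rewrite mem_enum !inE /= /path_adj => uv ->.
by case/orP: uv => /eqP <-; rewrite /= eqxx ?orbT.
Qed.

(** Edges from [2j] to [2j+1] cross between the set and its complement, while edges from [2j+1] to
    [2j+2] stay on one side. So each vertex has at most one neighbour on the opposite side. *)
Definition path_blocks n : {set path_graph n} :=
  [set i : 'I_n | (i %% 4 == 1) || (i %% 4 == 2)].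

(* The witness is the other vertex of the pair [2j, 2j+1] containing [u]. *)
Lemma path_blocks_crossing k (S := path_blocks (2 * k))
    (u : path_graph (2 * k)) :
  exists2 v, (v \in S) != (u \in S) &
    forall w, adj v w && ((w \in S) == (u \in S)) = (w == u).
Proof.
(* The number of vertices is even, so no vertex is left unpaired. *)
have ltv : (if odd u then u.-1 else u.+1) < 2 * k.
  by have := ltn_ord u; case: ifP; lia.
exists (Ordinal ltv) => [|w]; rewrite !inE /=; first by case: ifP; lia.
rewrite /path_adj /= -val_eqE /=.
by case: ifP => uo; apply/idP/idP; lia.
Qed.

(** The hypothesis is invariant under complementing [S], so it serves for both [S] and [~: S]. *)
Lemma super_dominating_crossing (G : sgraph) (S : {set G}) :
    (forall u : G, exists2 v, (v \in S) != (u \in S) &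
       forall w, adj v w && ((w \in S) == (u \in S)) = (w == u)) ->
  super_dominating S.
Proof.
move=> cross; apply/super_dominatingP => u uS.
have [v] := cross u; rewrite (negPf uS) eqbF_neg negbK => vS vw.
by exists v => //; apply/setP => w; rewrite !inE -vw eqbF_neg.
Qed.

Theorem theorem5p3 (k : nat) (hk : 4 <= 2 * k) :
  super_coalition_number (path_graph (2 * k)) = 4.
Proof.
apply/eqP; rewrite eqn_leq; apply/andP; split.
  apply/bigmax_leqP => P.
  exact: super_coalition_partition_card (@card_nbh_path _).
pose vtx i (hi : i < 4) : path_graph (2 * k) := Ordinal (leq_trans hi hk).
pose S := path_blocks (2 * k).
have cross := @path_blocks_crossing k.
apply: (@super_coalition_number_ge4 _ S (vtx 1 isT) (vtx 2 isT)
  (vtx 0 isT) (vtx 3 isT)); rewrite ?inE //; apply: super_dominating_crossing => // u.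
(* Complementing negates both sides of every membership comparison. *)
have [v vu vw] := cross u; by exists v => [|w]; rewrite !in_setC (inj_eq negb_inj).
Qed.
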